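(* Let $G$ be a finite group, $N$ a normal subgroup of $G$, $R\subseteq G$, and let $X=(R;S)$ be a pseudo-Cayley graph. If $X$ is $N^{\wedge}$-vertex rough generating, then the graph $\overline{X}'=(N^{\wedge}(R);S)$ is connected. Similarly, if $X$ is $N_{-}$-vertex rough generating, then the graph $\underline{X}'=(N_{-}(R);S\cap N_{-}(R))$ is connected.
   Context: Graphs are simple and undirected: a graph is a pair (vertex set, edge set) with edges being 2-element subsets of the vertex set. A non-empty graph is connected if any two vertices are linked by a path. Let $G$ be a finite group with identity $1$. Let $S\subset G$ with $1\notin S$ and $s\in S\Rightarrow s^{-1}\in S$. If $R\subseteq G$ is a subset (not necessarily a subgroup) with $S\subseteq R$ and $SR\subseteq R$, where $SR=\{sr: s\in S,r\in R\}$, the pseudo-Cayley graph $(R;S)$ has vertex set $R$, with an edge between two vertices $r$ and $rs$ (both in $R$) if and only if $s\in S$. For a normal subgroup $N$ of $G$ and $A\subseteq G$, put $N_{-}(A)=\{x\in G: xN\subseteq A\}$ and $N^{\wedge}(A)=\{x\in G: xN\cap A\neq\emptyset\}$. For a pseudo-Cayley graph $X=(R;S)$, put $\overline{X}'=(N^{\wedge}(R);S)$ and $\underline{X}'=(N_{-}(R);S\cap N_{-}(R))$; these are again pseudo-Cayley graphs. $X$ is called $N^{\wedge}$-vertex rough generating if $N^{\wedge}(R)$ is a subgroup of $G$ and $S$ is a generating set for $N^{\wedge}(R)$; it is called $N_{-}$-vertex rough generating if $N_{-}(R)$ is a subgroup of $G$ and $S$ is a generating set for $N_{-}(R)$ (in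 particular $S\subseteq N_{-}(R)$). *)

(* Defs.v *)
From mathcomp Require Import all_boot all_fingroup.

Set Implicit Arguments.
Unset Strict Implicit.
Unset Printing Implicit Defensive.

Local Open Scope group_scope.

Record sgraph (T : finType) := SGraph {
  vertices : {set T};
  edges : {set {set T}};
  edgesP : forall e, e \in edges -> e \subset vertices /\ #|e| = 2
}.

Definition adjacent (T : finType) (g : sgraph T) : rel T :=
  fun x y => [set x; y] \in edges g.

Definition graph_connected (T : finType) (g : sgraph T) : Prop :=
  vertices g != set0 /\
  {in vertices g &, forall x y, connect (adjacent g) x y}.

(* The data (R; S); S \subset G follows from S \subset R and R \subset G. *)
Record pseudo_cayley (gT : finGroupType) (G : {group gT}) := PseudoCayley {
  pc_R : {set gT};
  pc_S : {set gT};
  pc_R_sub : pc_R \subset G;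
  pc_S_neq1 : 1 \notin pc_S;
  pc_S_inv : {in pc_S, forall s, s^-1 \in pc_S};
  pc_S_sub : pc_S \subset pc_R;
  pc_SR_sub : pc_S * pc_R \subset pc_R
}.

Section PseudoCayley.
Variables (gT : finGroupType) (G : {group gT}).
Implicit Types (N : {group gT}) (A R S : {set gT}) (X : pseudo_cayley G).

(* The vertex set is closed under left multiplication by S, whereas edges come
   from right multiplication, so r * s need not be a vertex in general. *)
Definition pc_edges R S : {set {set gT}} :=
  [set e | [exists r in R, exists s in S,
              (r * s \in R) && (e == [set r; r * s])]].

Lemma pc_edgesP X e :
  e \in pc_edges (pc_R X) (pc_S X) -> e \subset pc_R X /\ #|e| = 2.
Proof.
rewrite inE => /exists_inP[r rR /exists_inP[s sS /andP[rsR /eqP->]]].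
split; first by apply/subsetP=> x; rewrite !inE => /orP[] /eqP->.
rewrite cards2 -{1}[r]mulg1 (inj_eq (mulgI r)).
by case: eqP => // s1; move: (pc_S_neq1 X); rewrite s1 sS.
Qed.

Definition pc_graph X : sgraph gT := SGraph (@pc_edgesP X).

Definition lower_approx N A : {set gT} := [set x in G | x *: N \subset A].

Definition upper_approx N A : {set gT} :=
  [set x in G | x *: N :&: A != set0].

Lemma pc_S_inG X s : s \in pc_S X -> s \in G.
Proof. by move/(subsetP (pc_S_sub X))/(subsetP (pc_R_sub X)). Qed.

Lemma pc_mulSR X s r : s \in pc_S X -> r \in pc_R X -> s * r \in pc_R X.
Proof. by move=> sS rR; rewrite (subsetP (pc_SR_sub X)) ?mem_mulg. Qed.

Lemma mul_lower N X s x : s \in pc_S X -> x \in lower_approx N (pc_R X) ->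
  s * x \in lower_approx N (pc_R X).
Proof.
move=> sS; rewrite !inE => /andP[xG /subsetP sxR].
rewrite groupM ?(pc_S_inG sS) //=.
apply/subsetP=> _ /lcosetP[n nN ->]; rewrite -mulgA pc_mulSR //.
by apply: sxR; apply/lcosetP; exists n.
Qed.

Fact upper_R_sub N X : upper_approx N (pc_R X) \subset G.
Proof. by apply/subsetP=> x; rewrite inE => /andP[]. Qed.

Fact upper_S_sub N X : pc_S X \subset upper_approx N (pc_R X).
Proof.
apply/subsetP=> s sS; rewrite inE (pc_S_inG sS) /=.
apply/set0Pn; exists s; rewrite inE lcoset_refl.
exact: (subsetP (pc_S_sub X)).
Qed.

Fact upper_SR_sub N X :
  pc_S X * upper_approx N (pc_R X) \subset upper_approx N (pc_R X).
Proof.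
apply/subsetP=> _ /mulsgP[s x sS + ->]; rewrite !inE => /andP[xG].
case/set0Pn=> _ /setIP[/lcosetP[n nN ->] xnR].
rewrite groupM ?(pc_S_inG sS) //=; apply/set0Pn; exists (s * (x * n)).
by rewrite inE pc_mulSR // andbT mulgA; apply/lcosetP; exists n.
Qed.

Definition upper_pc N X : pseudo_cayley G :=
  PseudoCayley (upper_R_sub N X) (pc_S_neq1 X) (@pc_S_inv _ _ X)
    (upper_S_sub N X) (upper_SR_sub N X).

Fact lower_R_sub N X : lower_approx N (pc_R X) \subset G.
Proof. by apply/subsetP=> x; rewrite inE => /andP[]. Qed.

Fact lower_S_neq1 N X : 1 \notin pc_S X :&: lower_approx N (pc_R X).
Proof. by rewrite inE (negPf (pc_S_neq1 X)). Qed.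

Fact lower_S_inv N X :
  {in pc_S X :&: lower_approx N (pc_R X),
    forall s, s^-1 \in pc_S X :&: lower_approx N (pc_R X)}.
Proof.
move=> s /setIP[sS sL]; have sVS := pc_S_inv sS.
rewrite inE sVS; suff: s^-1 * (s^-1 * s) \in lower_approx N (pc_R X) by rewrite mulVg mulg1.
by do 2!apply: mul_lower => //.
Qed.

Fact lower_SR_sub N X :
  (pc_S X :&: lower_approx N (pc_R X)) * lower_approx N (pc_R X)
    \subset lower_approx N (pc_R X).
Proof. by apply/subsetP=> _ /mulsgP[s x /setIP[sS _] xL ->]; apply: mul_lower. Qed.

Definition lower_pc N X : pseudo_cayley G :=
  PseudoCayley (lower_R_sub N X) (lower_S_neq1 N X) (@lower_S_inv N X)
    (subsetIr (pc_S X) (lower_approx N (pc_R X))) (lower_SR_sub N X).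

Definition upper_vertex_rough_generating N X : Prop :=
  [/\ group_set (upper_approx N (pc_R X)), upper_approx N (pc_R X) \subset G
    & <<pc_S X>> = upper_approx N (pc_R X)].

(* Generation is by all of S, which forces S \subset lower_approx N R. *)
Definition lower_vertex_rough_generating N X : Prop :=
  [/\ group_set (lower_approx N (pc_R X)), lower_approx N (pc_R X) \subset G
    & <<pc_S X>> = lower_approx N (pc_R X)].

End PseudoCayley.

(* Main.v *)
Require Import Defs.
From mathcomp Require Import all_boot all_fingroup.

(** If [S] generates the vertex set, then [x^-1 * y] is a word in [S], and multiplying [x] on the
    right by its letters one at a time walks from [x] to [y]. Both approximation graphs are
    instances of this. *)

Lemma connected_of_gen (gT : finGroupType) (G : {group gT})
    (X : pseudo_cayley G) :
  (<<pc_S X>>)%g = pc_R X -> graph_connected (pc_graph X).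
Proof.
move=> genS; split=> [|x y]; rewrite /= -genS.
  by apply/set0Pn; exists 1%g; apply: group1.
move=> xS yS; rewrite -(mulKVg x y).
have /gen_prodgP[n [c cS ->]] : (x^-1 * y)%g \in <<pc_S X>>%g.
  by rewrite groupM ?groupV.
(* The start [x] stays general: each step of the walk moves it to [x * c ord0]. *)
elim: n c cS x xS {y yS} => [c _ x _|n IHn c cS x xS].
  by rewrite big_ord0 mulg1.
(* The axioms give closure under left multiplication by [S]; right multiplication stays among the
   vertices because they form the group generated by [S]. *)
have xcS : (x * c ord0)%g \in <<pc_S X>>%g by rewrite groupM ?xS ?mem_gen.
rewrite big_ord_recl mulgA; apply: connect_trans (IHn _ _ _ xcS) => //.
apply: connect1; rewrite /adjacent /= inE -genS.
apply/exists_inP; exists x => //; apply/exists_inP; exists (c ord0) => //.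
by rewrite xcS /=.
Qed.

Theorem theorem5p9 (gT : finGroupType) (G N : {group gT}) (nNG : (N <| G)%g)
    (X : pseudo_cayley G) :
  (upper_vertex_rough_generating N X ->
     graph_connected (pc_graph (upper_pc N X))) /\
  (lower_vertex_rough_generating N X ->
     graph_connected (pc_graph (lower_pc N X))).
Proof.
split=> -[_ _ genS]; apply: connected_of_gen => //=.
(* In the lower case, generation puts [S] inside the approximation, so the intersection is [S]
   itself. *)
by rewrite (setIidPl _) // -genS subset_gen.
Qed.
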